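(* Let $n\geq 1$ be an integer. If $X$ is a $T_{1}$ $n$-Urysohn space, then $|X|\leq UW(X)\cdot 2^{\theta\text{-}aL_{\theta}(X)\,\chi(X)}$.
   Context: For $A\subseteq X$, the $\theta$-closure is $cl_{\theta}(A)=\{x\in X:\ \overline{U}\cap A\neq\emptyset \text{ for every open neighborhood } U \text{ of } x\}$; $A$ is $\theta$-closed if $A=cl_{\theta}(A)$. A space $X$ is $n$-Urysohn if for all pairwise distinct points $x_1,\dots,x_n\in X$ there exist open sets $U_1,\dots,U_n$ with $x_i\in U_i$ for each $i$ and $\bigcap_{i=1}^{n}\overline{U_i}=\emptyset$. For a $T_1$ space $X$ and $x\in X$, $Uw(x)=\bigcap\{cl_{\theta}(\overline{U}):x\in U,\ U\text{ open}\}$, and the Urysohn width is $UW(X)=\sup\{|Uw(x)|:x\in X\}$ (this value may be finite). For $Y\subseteq X$, $\theta\text{-}aL(Y,X)$ is the least cardinal $\kappa$ such that every cover $\mathcal{V}$ of $Y$ by open subsets of $X$ has a subfamily $\mathcal{V}'\subseteq\mathcal{V}$ with $|\mathcal{V}'|\leq\kappa$ and $Y\subseteq\bigcup\{cl_{\theta}(\overline{V}):V\in\mathcal{V}'\}$, where closures and $\theta$-closures are taken in $X$. Further, $\theta\text{-}aL_{\theta}(X)=\sup\{\theta\text{-}aL(B,X):B\subseteq X\text{ is }\theta\text{-closed}\}$. $\chi(X)$ is the character of $X$. Convention: the cardinal functions $\theta\text{-}aL_\theta$ and $\chi$ are taken to be infinite-valued (i.e. $\aleph_0$ is added: $\theta\text{-}aL_{\theta}(X)$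 stands for $\aleph_0+\sup\{\theta\text{-}aL(B,X):B\subseteq X\text{ is }\theta\text{-closed}\}$, and $\chi(X)$ stands for $\aleph_0$ plus the supremum over $x\in X$ of the least cardinality of a local base at $x$); $UW(X)$ is not modified. *)

(* Defs.v *)
From mathcomp Require Import all_boot.
From mathcomp Require Import boolp classical_sets functions cardinality.
From mathcomp Require Import topology.

Set Implicit Arguments.
Unset Strict Implicit.
Unset Printing Implicit Defensive.

Local Open Scope classical_set_scope.
Local Open Scope card_scope.

(* A cardinal is represented by a set of that cardinality, compared by [#<=].
   [least_card P] is a set of least cardinality among those satisfying [P];
   by [least_cardP] it exists as soon as [P] is satisfiable. *)
Definition least_card (T : Type) (P : set (set T)) : set T :=
  xget set0 [set K | P K /\ forall K', P K' -> K #<= K'].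

(* All the sets [F i] live in the same type [T], so that the least upper bound
   of their cardinalities is always realised by a subset of [T]; it is below
   any bound living in any other type, see [sup_card_le]. *)
Definition sup_card (I T : Type) (D : set I) (F : I -> set T) : set T :=
  least_card [set K | forall i, D i -> F i #<= K].

Definition cl_theta (X : topologicalType) (A : set X) : set X :=
  [set x | forall U, open_nbhs x U -> closure U `&` A !=set0].

Definition theta_closed (X : topologicalType) (A : set X) : Prop :=
  A = cl_theta A.

Definition n_Urysohn (n : nat) (X : topologicalType) : Prop :=
  forall x : 'I_n -> X, injective x ->
  exists U : 'I_n -> set X,
    (forall i, open_nbhs (x i) (U i)) /\
    \bigcap_(i in [set: 'I_n]) closure (U i) = set0.

Definition Uw (X : topologicalType) (x : X) : set X :=
  \bigcap_(U in open_nbhs x) cl_theta (closure U).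

Definition UW (X : topologicalType) : set X := sup_card [set: X] (@Uw X).
Arguments UW : clear implicits.

(* The covers are subsets of [set X], so that the least cardinal is realised
   by a subset of [set X]; see [theta_aL_le] for bounds in other types. *)
Definition theta_aL_bound (X : topologicalType) (Y : set X)
    (T : Type) (K : set T) : Prop :=
  forall V : set (set X), V `<=` open -> Y `<=` \bigcup_(v in V) v ->
  exists V' : set (set X),
    [/\ V' `<=` V, V' #<= K & Y `<=` \bigcup_(v in V') cl_theta (closure v)].

Definition theta_aL (X : topologicalType) (Y : set X) : set (set X) :=
  least_card [set K : set (set X) | theta_aL_bound Y K].

(* Disjoint union with [nat] is the addition of aleph_0. *)
Definition theta_aL_theta (X : topologicalType) : Type :=
  (nat + sup_card [set B : set X | theta_closed B] (@theta_aL X))%type.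

Definition local_base (X : topologicalType) (x : X) (B : set (set X)) : Prop :=
  B `<=` open_nbhs x /\
  forall U, open_nbhs x U -> exists2 V, B V & V `<=` U.

Definition local_character (X : topologicalType) (x : X) : set (set X) :=
  least_card (local_base x).

Definition character (X : topologicalType) : Type :=
  (nat + sup_card [set: X] (@local_character X))%type.

Lemma least_card_ex (T : Type) (P : set (set T)) (K0 : set T) : P K0 ->
  exists K, P K /\ forall K', P K' -> K #<= K'.
Proof.
move=> PK0.
pose Q (G : set (set T -> T)) := forall K, P K ->
  (forall g, G g -> K (g K)) /\
  (forall g h, G g -> G h -> g K = h K -> g = h).
have [F FQ Ftot|G [QG Gmax]] := @Zorn_bigcup _ Q.
  move=> K PK; split=> [g [A FA Ag]|g h [A FA Ag] [B FB Bh] ghK].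
    exact: (FQ _ FA K PK).1.
  have [AB|BA] := Ftot _ _ FA FB.
    exact: (FQ _ FB K PK).2 (AB _ Ag) Bh ghK.
  exact: (FQ _ FA K PK).2 Ag (BA _ Bh) ghK.
have [K [PK KG]] : exists K, P K /\ K `<=` (fun g => g K) @` G.
  apply: contrapT => nK.
  have nKt K : P K -> exists t, K t /\ ~ ((fun g => g K) @` G) t.
    move=> PK; apply: contrapT => nt; apply: nK; exists K; split=> // t Kt.
    by apply: contrapT => Gt; apply: nt; exists t.
  have [t0 _] := nKt _ PK0.
  have /choice[g gP] : forall K, exists t,
      P K -> K t /\ ~ ((fun g => g K) @` G) t.
    move=> K; have [/nKt[t tP]|nPK] := pselect (P K); first by exists t.
    by exists t0.
  have nGg : ~ G g by move=> Gg; have [_] := gP _ PK0; apply; exists g.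
  apply: (Gmax (G `|` [set g])).
    split; first by move=> h Gh; left.
    by move=> /(_ g) sub; apply: nGg; apply: sub; right.
  move=> K PK; have [Kg nGK] := gP _ PK; have [GK Ginj] := QG _ PK.
  split=> [h [/GK //|->//]|h k [Gh|->] [Gk|->] // hk].
  - exact: Ginj.
  - by case: nGK; exists h.
  - by case: nGK; exists k.
exists K; split=> // K' PK'.
apply: card_le_trans (subset_card_le KG) _.
apply: card_le_trans (card_image_le _ _) _.
have Ginj : {in G &, injective (fun g : set T -> T => g K')}.
  by move=> g h /set_mem Gg /set_mem Gh; apply: (QG _ PK').2.
rewrite -(card_le_eql (inj_card_eq Ginj)); apply: subset_card_le => _ [g Gg <-].
exact: (QG _ PK').1.
Qed.

Lemma least_cardP (T : Type) (P : set (set T)) (K0 : set T) : P K0 ->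
  P (least_card P) /\ forall K, P K -> least_card P #<= K.
Proof. by move=> /least_card_ex /(xgetPex set0). Qed.

Lemma card_le_total (T U : Type) (A : set T) (B : set U) :
  A #<= B \/ B #<= A.
Proof.
pose A' : set (T + U) := inl @` A; pose B' : set (T + U) := inr @` B.
have AA' : A' #= A by apply: inj_card_eq => ? ? _ _ [].
have BB' : B' #= B by apply: inj_card_eq => ? ? _ _ [].
have [|K [KAB Kmin]] := @least_card_ex _ [set A'; B'] A'; first by left.
have KA' : K #<= A' by apply: Kmin; left.
have KB' : K #<= B' by apply: Kmin; right.
case: KAB KA' KB' => -> h h'.
  by left; rewrite -(card_le_eql AA') -(card_le_eqr BB').
by right; rewrite -(card_le_eqr AA') -(card_le_eql BB').
Qed.

Lemma least_card_le (T U : Type) (P : set (set T)) (K0 : set T) (B : set U) :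
  P K0 -> (forall K : set T, K #= B -> P K) -> least_card P #<= B.
Proof.
move=> /least_cardP[_ Pmin] PB.
have [TB|BT] := card_le_total [set: T] B.
  exact: card_le_trans (card_leT _) TB.
have /card_subP[K KB _] := BT.
by rewrite -(card_le_eqr KB); exact/Pmin/PB.
Qed.

Lemma sup_card_ge (I T : Type) (D : set I) (F : I -> set T) (i : I) :
  D i -> F i #<= sup_card D F.
Proof.
have FT : forall j, D j -> F j #<= [set: T] by move=> j _; exact: card_leT.
have [+ _] := @least_cardP _ [set K | forall j, D j -> F j #<= K] _ FT.
exact.
Qed.

Lemma sup_card_le (I T U : Type) (D : set I) (F : I -> set T) (B : set U) :
  (forall i, D i -> F i #<= B) -> sup_card D F #<= B.
Proof.
move=> FB; apply: (@least_card_le _ _ _ setT).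
  by move=> j _; exact: card_leT.
by move=> K KB i Di; rewrite (card_le_eqr KB); exact: FB.
Qed.

Lemma theta_aLP (X : topologicalType) (Y : set X) :
  theta_aL_bound Y (theta_aL Y).
Proof.
have YT : theta_aL_bound Y [set: set X].
  move=> V Vo YV; exists V; split=> //; first exact: card_leT.
  move=> x /YV[v Vv vx]; exists v => // U [_ Ux].
  by exists x; split; exact: subset_closure.
by have [] := @least_cardP _ [set K | theta_aL_bound Y K] _ YT.
Qed.

Lemma theta_aL_le (X : topologicalType) (Y : set X) (T : Type) (K : set T) :
  theta_aL_bound Y K -> theta_aL Y #<= K.
Proof.
move=> YK; apply: (@least_card_le _ _ _ (theta_aL Y)); first exact: theta_aLP.
move=> K' KK' V Vo YV; have [V' [V'V V'K YV']] := YK V Vo YV.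
by exists V'; split=> //; rewrite (card_le_eqr KK').
Qed.

Lemma local_characterP (X : topologicalType) (x : X) :
  local_base x (local_character x) /\
  forall B, local_base x B -> local_character x #<= B.
Proof.
by apply: (@least_cardP _ _ (open_nbhs x)); split=> // U xU; exists U.
Qed.

(* Main.v *)
Require Import Defs.
From mathcomp Require Import all_boot.
From mathcomp Require Import boolp classical_sets functions cardinality.
From mathcomp Require Import topology.

(** Write [kappa] for the product of the theta-almost Lindelof degree and the
character, [K] for the infinite type that represents it, and enumerate an open
local base [U x k] at every point [x] by [k : K].  The point [y] lies in [Uw x]
exactly when [x] and [y] have no open neighbourhoods with disjoint closures.
The bound follows from a set [H] of at most [2 ^ kappa] points such that the
sets [Uw x], [x] in [H], cover the space ([Uw_cover]): each of them has at most
[UW X] points, so [card_le_bigcup] applies.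

The set [H] is required to be theta-closed, and to meet the complement of every
union of at most [kappa] sets [cl_theta (closure (U x k))], [x] in [H], that is
not the whole space.  Such an [H] works.  If [q] were in no [Uw x], then every
[x] in [H] would have a basic neighbourhood [U x k] with [q] outside
[cl_theta (closure (U x k))]; since [H] is theta-closed, [kappa] of these
neighbourhoods suffice for the sets [cl_theta (closure (U x k))] to cover [H].
These sets miss [q], so they also miss a point of [H], which is absurd.

The second requirement is closure under an operation on [kappa]-sequences of
points.  So is the first one, and this is where the [n]-Urysohn property comes
in.  A point [x] of [cl_theta H] is described by a sequence [f : K -> H] with
[f k] in [closure (U x k)], together with the relation between [k] and [j] that
[f j] lies in [closure (U x k)].  Points sharing the same description cannot be
separated in the [n]-Urysohn sense, so only finitely many of them exist
([closure_trace_fiber_finite]), and an integer tells them apart.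

It remains to close a point under [2 ^ kappa] operations of arity [kappa]
without exceeding [2 ^ kappa] points ([infinitary_hull]).  The elements
generated are the values of well-founded [K]-branching trees, and such a tree is
determined by the labels it carries at finite sequences of elements of [K];
there are [kappa] such sequences because [kappa] is equal to its own square
([infinite_square], by Zorn's lemma). *)

Set Implicit Arguments.
Unset Strict Implicit.

Local Open Scope classical_set_scope.
Local Open Scope card_scope.

(** * Injections, surjections and comparison of cardinals *)

(** The point [u] makes a total function available even when [A] is empty. *)
Lemma card_le_injP (T U : Type) (A : set T) (B : set U) (u : U) :
  A #<= B <->
  exists f : T -> U, (forall x, A x -> B (f x)) /\
    (forall x y, A x -> A y -> f x = f y -> x = y).
Proof.
split.
  elim/Ppointed: U => U in u B *; first by case: (no u).
  move=> /pcard_leP[f]; exists f; split=> [x Ax|x y Ax Ay]; first exact: funS.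
  by apply: inj; exact/mem_set.
move=> [f [fB fI]].
have fA : f @` A #= A.
  by apply: inj_card_eq => x y /set_mem Ax /set_mem Ay; exact: fI.
by rewrite -(card_le_eql fA); apply: subset_card_le => _ [x /fB + <-].
Qed.

Lemma card_le_injT (T U : Type) (f : T -> U) :
  injective f -> [set: T] #<= [set: U].
Proof.
move=> fI; have fT : f @` [set: T] #= [set: T].
  by apply: inj_card_eq => x y _ _ /fI.
by rewrite -(card_le_eql fT); exact: card_leT.
Qed.

Lemma card_le_surj (T U : Type) (A : set T) (B : set U) (x0 : T) :
  A x0 -> A #<= B ->
  exists g : U -> T, (forall u, A (g u)) /\
    (forall x, A x -> exists2 u, B u & g u = x).
Proof.
move=> Ax0 /pfcard_geP[A0|[g]]; first by move: Ax0; rewrite A0.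
exists (fun u => if pselect (B u) then g u else x0); split=> [u|x Ax].
  by case: pselect => // Bu; exact: funS.
have [u Bu gu] : (g @` B) x by exact: surj.
by exists u => //; case: pselect.
Qed.

Lemma card_le_inr (A T : Type) (K : set T) (B : Type) (f : sum A K -> B) :
  injective f -> K #<= [set: B].
Proof.
move=> fI; rewrite -(card_le_eql (card_setT K)).
by apply: (@card_le_injT _ _ (fun k => f (inr k))) => x y /fI[].
Qed.

Lemma card_le_set (A B : Type) : [set: A] #<= [set: B] ->
  [set: set A] #<= [set: set B].
Proof.
have [[b _]|nB] := pselect (exists b : B, True); last first.
  move=> /card_leP[f]; apply: (@card_le_injT _ _ (fun=> set0)) => P Q _.
  have nA (a : A) : False.
    by case: nB; exists (val (f (SigSub (mem_set (I : [set: A] a))))).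
  by apply/seteqP; split=> a _; case: (nA a).
move=> /(card_le_injP _ _ b)[f [_ fI]].
apply: (@card_le_injT _ _ (fun P => f @` P)) => P Q /seteqP[PQ QP].
apply/seteqP; split=> a aP.
  by have [|a' Qa' /fI<-] := PQ (f a); first by exists a.
by have [|a' Pa' /fI<-] := QP (f a); first by exists a.
Qed.

(** After a choice of an index [j t] with [t] in [F (j t)], a point [t] is
determined by [j t] and by its place in [F (j t)]. *)
Lemma card_le_bigcup (I T A B : Type) (D : set I) (F : I -> set T)
    (K : set A) (L : set B) :
  D #<= L -> (forall i, D i -> F i #<= K) ->
  \bigcup_(i in D) F i #<= K `*` L.
Proof.
move=> DL FK; have [->//|/set0P[t0 [i0 Di0 Ft0]]] :=
  eqVneq (\bigcup_(i in D) F i) set0.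
have ex0 (A' B' : Type) (P : set A') (Q : set B') a : P a -> P #<= Q ->
    exists b, Q b.
  move=> Pa PQ; apply: contrapT => nQ; suff : P #<= (@set0 B').
    by move=> /card_le0P P0; rewrite P0 in Pa.
  apply: card_le_trans PQ (subset_card_le _) => b Qb; exfalso.
  by apply: nQ; exists b.
have [a0 _] := ex0 _ _ _ _ _ Ft0 (FK _ Di0).
have [b0 _] := ex0 _ _ _ _ _ Di0 DL.
have [d [dL dI]] := (card_le_injP _ _ b0).1 DL.
have /choice[f fP] : forall i, exists f : T -> A, D i ->
    (forall x, F i x -> K (f x)) /\
    (forall x y, F i x -> F i y -> f x = f y -> x = y).
  move=> i; have [Di|nDi] := pselect (D i); last by exists (fun=> a0) => /nDi.
  by have [f fP] := (card_le_injP _ _ a0).1 (FK _ Di); exists f.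
have /choice[j jP] : forall t, exists i,
    (\bigcup_(i in D) F i) t -> D i /\ F i t.
  move=> t; have [[i Di Fi]|nt] := pselect ((\bigcup_(i in D) F i) t).
    by exists i.
  by exists i0 => /nt.
apply/(card_le_injP _ _ (a0, b0)); exists (fun t => (f (j t) t, d (j t))).
split=> [t|t s] /jP[Dt Ft].
  by split; [apply: (fP _ Dt).1|exact: dL].
move=> /jP[Ds Fs] [e /(dI _ _ Dt Ds) jts].
by rewrite -jts in e Fs; exact: (fP _ Dt).2 e.
Qed.

(** * An infinite set is equipotent to its square *)

(** The set [A] for which [G] is meant to be a pairing is read off the diagonal
of its domain [A * A], so that Zorn's lemma only has to handle one set. *)
Definition diag (T : Type) (G : set (T * T * T)) : set T :=
  [set a | exists c, G (a, a, c)].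

(** [G] is the graph of an injection of [A * A] into [A], where [A] is [diag G].
A graph rather than a function makes the union of a chain immediate. *)
Definition pairing_graph (T : Type) (G : set (T * T * T)) : Prop :=
  [/\ forall a b, diag G a -> diag G b ->
        exists2 c, G (a, b, c) & diag G c,
      forall a b c, G (a, b, c) -> diag G a /\ diag G b,
      forall a b c c', G (a, b, c) -> G (a, b, c') -> c = c' &
      forall a b a' b' c, G (a, b, c) -> G (a', b', c) -> a = a' /\ b = b'].

Lemma pairing_graph_bigcup (T : Type) (F : set (set (T * T * T))) :
  F `<=` @pairing_graph T -> total_on F subset ->
  pairing_graph (\bigcup_(G in F) G).
Proof.
move=> FP Ftot.
have domU G : F G -> diag G `<=` diag (\bigcup_(G in F) G).
  by move=> FG a [c Gc]; exists c; exists G.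
have join G G' : F G -> F G' -> exists H, [/\ F H, G `<=` H & G' `<=` H].
  by move=> FG FG'; have [] := Ftot _ _ FG FG'; [exists G'|exists G]; split.
split=> [a b [c [G FG Gc]] [d [G' FG' G'd]]|a b c [G FG Gc]|
         a b c c' [G FG Gc] [G' FG' Gc']|a b a' b' c [G FG Gc] [G' FG' Gc']].
- have [H [FH GH G'H]] := join _ _ FG FG'; have [HD _ _ _] := FP _ FH.
  have [||e He De] := HD a b; [by exists c; exact: GH|by exists d; exact: G'H|].
  by exists e; [exists H|exact: domU De].
- have [_ GD _ _] := FP _ FG; have [Da Db] := GD _ _ _ Gc.
  by split; exact: domU FG _ _.
- have [H [FH GH G'H]] := join _ _ FG FG'; have [_ _ Hf _] := FP _ FH.
  exact: Hf (GH _ Gc) (G'H _ Gc').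
- have [H [FH GH G'H]] := join _ _ FG FG'; have [_ _ _ Hi] := FP _ FH.
  exact: Hi (GH _ Gc) (G'H _ Gc').
Qed.

Lemma pairing_graph_fun (T : Type) (G : set (T * T * T)) (t : T) :
  pairing_graph G ->
  exists f : T -> T -> T,
    (forall a b, diag G a -> diag G b -> G (a, b, f a b) /\ diag G (f a b)) /\
    (forall a b a' b', diag G a -> diag G b -> diag G a' -> diag G b' ->
     f a b = f a' b' -> a = a' /\ b = b').
Proof.
move=> [GD _ _ GI].
have /choice[f fP] : forall p : T * T, exists c,
    diag G p.1 -> diag G p.2 -> G (p.1, p.2, c) /\ diag G c.
  move=> [a b]; have [[Da Db]|nD] := pselect (diag G a /\ diag G b).
    by have [c Gc Dc] := GD _ _ Da Db; exists c.
  by exists t => Da Db; case: nD.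
have fD a b : diag G a -> diag G b -> G (a, b, f (a, b)) /\ diag G (f (a, b)).
  exact: fP (a, b).
exists (fun a b => f (a, b)); split=> // a b a' b' Da Db Da' Db' e.
have [+ _] := fD _ _ Da Db; have [+ _] := fD _ _ Da' Db'.
by rewrite e => Gc' Gc; exact: GI Gc Gc'.
Qed.

(** If [A = diag G] embeds in its complement by [h], the pairing [f] of [A]
extends to [A] together with [h @` A]: the three new blocks of the square have
the size of [A * A], and [f] with three distinct tags [a0], [a1], [a2] packs
them injectively into [A], hence into [h @` A].  A pairing that is maximal thus
has a large domain. *)
Lemma pairing_graph_extend (T : Type) (G : set (T * T * T)) (a0 a1 a2 : T) :
  pairing_graph G -> diag G a0 -> diag G a1 -> diag G a2 ->
  a0 <> a1 -> a0 <> a2 -> a1 <> a2 ->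
  diag G #<= ~` diag G ->
  exists G', [/\ pairing_graph G', G `<=` G' & ~ (G' `<=` G)].
Proof.
move=> PG D0 D1 D2 n01 n02 n12 /(card_le_injP _ _ a0) [h [hD hI]].
have [f [fD fI]] := pairing_graph_fun a0 PG; have [GD Gd Gf GI] := PG.
pose v t a b := h (f t (f a b)).
pose A := diag G.
have vD t a b : A t -> A a -> A b -> A (f t (f a b)).
  by move=> At Aa Ab; have [_ Df] := fD _ _ Aa Ab; have [] := fD _ _ At Df.
have vI t a b t' a' b' : A t -> A a -> A b -> A t' -> A a' -> A b' ->
    v t a b = v t' a' b' -> [/\ t = t', a = a' & b = b'].
  move=> At Aa Ab At' Aa' Ab' /hI e.
  have {}e := e (vD _ _ _ At Aa Ab) (vD _ _ _ At' Aa' Ab').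
  have [_ Df] := fD _ _ Aa Ab; have [_ Df'] := fD _ _ Aa' Ab'.
  have [-> /fI e'] := fI _ _ _ _ At Df At' Df' e.
  by have [-> ->] := e' Aa Ab Aa' Ab'.
pose G' : set (T * T * T) := [set p | G p \/ exists a b, A a /\ A b /\
  (p = (h a, b, v a0 a b) \/ p = (a, h b, v a1 a b) \/
   p = (h a, h b, v a2 a b))].
have GG' : G `<=` G' by move=> p; left.
have DG' a : A a -> diag G' a by move=> [c Gc]; exists c; left.
have Dh a : A a -> diag G' (h a).
  move=> Aa; exists (v a2 a a); right; exists a, a.
  by do 2!split=> //; right; right.
have DG'P x : diag G' x -> A x \/ exists2 a, A a & x = h a.
  move=> [c [Gc|[a [b [Aa [Ab H]]]]]]; first by left; exists c.
  by case: H => [[->]|[[->]|[->]]] *; [right; exists a|left|right; exists a].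
have Gdom a b c : G (a, b, c) -> [/\ A a, A b & A c].
  move=> Gc; have [Da Db] := Gd _ _ _ Gc; have [c' Gc' Dc'] := GD _ _ Da Db.
  by rewrite (Gf _ _ _ _ Gc Gc').
have nh a : A a -> ~ A (h a) by exact: hD.
have nv t a b : A t -> A a -> A b -> ~ A (v t a b).
  by move=> At Aa Ab; apply: nh; exact: vD.
exists G'; split=> //; last first.
  move=> /(_ (h a0, a0, v a0 a0 a0)) G'G.
  have [|/(nh _ D0)//] := Gdom _ _ _ (G'G _).
  by right; exists a0, a0; do 2!split=> //; left.
split.
- move=> x y /DG'P[Ax|[a Aa ->]] /DG'P[Ay|[b Ab ->]].
  + by have [c Gc Dc] := GD _ _ Ax Ay; exists c; [left|exact: DG'].
  + exists (v a1 x b); last by apply: Dh; exact: vD.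
    by right; exists x, b; do 2!split=> //; right; left.
  + exists (v a0 a y); last by apply: Dh; exact: vD.
    by right; exists a, y; do 2!split=> //; left.
  + exists (v a2 a b); last by apply: Dh; exact: vD.
    by right; exists a, b; do 2!split=> //; right; right.
- move=> x y z [/Gdom[Ax Ay _]|]; first by split; exact: DG'.
  by move=> [a [b [Aa [Ab [[-> -> _]|[[-> -> _]|[-> -> _]]]]]]]; split;
     by [exact: DG'|exact: Dh].
- move=> x y z z' [Gz|[a [b [Aa [Ab H]]]]] [Gz'|[a' [b' [Aa' [Ab' H']]]]].
  + exact: Gf Gz Gz'.
  + have [Ax Ay _] := Gdom _ _ _ Gz.
    by case: H' => [[ex ey _]|[[ex ey _]|[ex ey _]]];
       [case: (nh a' Aa')|case: (nh b' Ab')|case: (nh a' Aa')];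
       rewrite -?ex -?ey.
  + have [Ax Ay _] := Gdom _ _ _ Gz'.
    by case: H => [[ex ey _]|[[ex ey _]|[ex ey _]]];
       [case: (nh a Aa)|case: (nh b Ab)|case: (nh a Aa)];
       rewrite -?ex -?ey.
  + case: H H' => [[-> -> ->]|[[-> -> ->]|[-> -> ->]]]
      [[ex ey ->]|[[ex ey ->]|[ex ey ->]]];
    (* equal arguments lie in the same block, as [h] avoids [A] *)
    try (by case: (nh a Aa); rewrite ex);
    try (by case: (nh b Ab); rewrite ey);
    try (by case: (nh a' Aa'); rewrite -ex);
    try (by case: (nh b' Ab'); rewrite -ey).
    * by rewrite (hI _ _ Aa Aa' ex) ey.
    * by rewrite (hI _ _ Ab Ab' ey) ex.
    * by rewrite (hI _ _ Ab Ab' ey) (hI _ _ Aa Aa' ex).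
- move=> x y x' y' z [Gz|[a [b [Aa [Ab H]]]]] [Gz'|[a' [b' [Aa' [Ab' H']]]]].
  + exact: GI Gz Gz'.
  + have [_ _ Az] := Gdom _ _ _ Gz.
    by case: H' => [[_ _ ez]|[[_ _ ez]|[_ _ ez]]];
       rewrite ez in Az; exfalso; apply: nv Az.
  + have [_ _ Az] := Gdom _ _ _ Gz'.
    by case: H => [[_ _ ez]|[[_ _ ez]|[_ _ ez]]];
       rewrite ez in Az; exfalso; apply: nv Az.
  + case: H H' => [[-> -> ->]|[[-> -> ->]|[-> -> ->]]]
      [[-> -> /vI e]|[[-> -> /vI e]|[-> -> /vI e]]]; case: e => // e -> -> //;
    by [case: n01|case: n02|case: n12].
Qed.

(** A maximal pairing [f], on a set [A], has a complement that embeds in [A] by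
some [g], for otherwise it would extend.  Then [T] embeds in [A], by two tags
for the two parts, and [f] finishes. *)
Lemma infinite_square (T : Type) : [set: nat] #<= [set: T] ->
  exists f : T * T -> T, injective f.
Proof.
move=> infT; have [t0 _] := infinite_setN0 ((infiniteP _).2 infT).
have [i [_ iI]] := (card_le_injP _ _ t0).1 infT.
have {}iI : injective i by move=> m n; exact: iI.
pose G0 : set (T * T * T) :=
  [set (i p.1, i p.2, i (choice.pickle p)) | p in [set: nat * nat]].
have dom0 m : diag G0 (i m) by exists (i (choice.pickle (m, m))), (m, m).
have P0 : pairing_graph G0.
  split=> [a b [c [[m ?] _ /= [<- _ _]]] [d [[n ?] _ [<- _ _]]]|
      a b c [[m n] _ [<- <- _]]|a b c c' [[m n] _ [<- <- <-]] [[m' n'] _]|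
      a b a' b' c [[m n] _ [<- <- <-]] [[m' n'] _]] //=.
  - by exists (i (choice.pickle (m, n))) => //; exists (m, n).
  - by move=> [/iI-> /iI-> <-].
  - by move=> [<- <- /iI/(pcan_inj choice.pickleK)[-> ->]].
(* The empty pairing must be allowed, as the union of the empty chain; all the
   others contain [G0], so that the maximal one has enough tags. *)
have [F FP Ftot|G [[PG G0G] Gmax]] := @Zorn_bigcup _
    [set G | pairing_graph G /\ (G !=set0 -> G0 `<=` G)].
  split; first by apply: pairing_graph_bigcup => // G /FP[].
  move=> [p [G FG Gp]] q G0q; exists G => //.
  by have [_ G0G] := FP _ FG; apply: G0G => //; exists p.
have {}G0G : G0 `<=` G.
  apply: contrapT => nG0G; apply: (Gmax G0); last by split=> // _ p.
  split=> // p Gp; by case: nG0G; apply: G0G; exists p.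
have Di m : diag G (i m) by have [c G0c] := dom0 m; exists c; exact: G0G.
have ni m n : m <> n -> i m <> i n by move=> mn /iI.
have [AB|BA] := card_le_total (diag G) (~` diag G).
  have [] := pairing_graph_extend PG (Di 0) (Di 1) (Di 2) _ _ _ AB;
    try exact: ni.
  move=> G' [PG' GG' nG'G]; case: (Gmax G') => //; split=> // _.
  exact: subset_trans G0G GG'.
have [g [gD gI]] := (card_le_injP _ _ t0).1 BA.
have [f [fD fI]] := pairing_graph_fun t0 PG.
pose e x := if pselect (diag G x) then f (i 0) x else f (i 1) (g x).
have eD x : diag G (e x).
  by rewrite /e; case: pselect => Dx; apply: (fD _ _ _ _).2 => //; exact: gD.
have eI : injective e.
  move=> x y; rewrite /e; case: pselect => Dx; case: pselect => Dy /fI[] //;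
    do ?exact: gD; try by move=> /iI.
  by move=> _ /gI; exact.
exists (fun p => f (e p.1) (e p.2)) => -[x y] [x' y'] /= /fI[] // /eI-> /eI->.
by [].
Qed.

Lemma infinite_prod (K A B : Type) : [set: nat] #<= [set: K] ->
  [set: A] #<= [set: K] -> [set: B] #<= [set: K] -> [set: A * B] #<= [set: K].
Proof.
move=> infK AK BK; have [k _] := infinite_setN0 ((infiniteP _).2 infK).
have [p pI] := infinite_square infK.
have [a [_ aI]] := (card_le_injP _ _ k).1 AK.
have [b [_ bI]] := (card_le_injP _ _ k).1 BK.
apply: (@card_le_injT _ _ (fun x => p (a x.1, b x.2))).
by move=> [x y] [x' y'] /pI/= [/aI-> // /bI->].
Qed.

Lemma infinite_sum (K A B : Type) : [set: nat] #<= [set: K] ->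
  [set: A] #<= [set: K] -> [set: B] #<= [set: K] -> [set: A + B] #<= [set: K].
Proof.
move=> infK AK BK; have [k _] := infinite_setN0 ((infiniteP _).2 infK).
have [a [_ aI]] := (card_le_injP _ _ k).1 AK.
have [b [_ bI]] := (card_le_injP _ _ k).1 BK.
apply: card_le_trans (infinite_prod infK infK (card_lexx _)).
apply: (@card_le_injT _ _ (fun x : A + B =>
  match x with inl x => (0, a x) | inr y => (1, b y) end)).
by move=> [x|x] [y|y] // [e]; [rewrite (aI x y)|rewrite (bI x y)].
Qed.

Lemma infinite_seq (K : Type) : [set: nat] #<= [set: K] ->
  [set: seq K] #<= [set: K].
Proof.
move=> infK; have [k _] := infinite_setN0 ((infiniteP _).2 infK).
have /(card_le_injP _ _ k)[p [_ pI]] := infinite_prod infK infK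
  (infinite_prod infK (card_lexx [set: K]) (card_lexx [set: K])).
pose enc := fix enc (s : seq K) :=
  if s is x :: s' then p (1, (x, enc s')) else p (0, (k, k)).
apply: (@card_le_injT _ _ enc); elim=> [|x s IH] [|y t] //= /pI e.
- by have := e I I.
- by have := e I I.
- by have [-> /IH->] := e I I.
Qed.

(** * Closing a set under infinitary operations *)

(** Formal terms: a node is an operation, named by a subset of [D], applied to a
[K]-sequence of terms. *)
Inductive tree (K D : Type) : Type :=
| Leaf
| Node of set D & (K -> tree K D).

(** A pair [(s, None)] says that a node sits at the address [s], and
[(s, Some d)] that moreover [d] belongs to its label.  The marker [None] keeps a
node with empty label apart from a leaf. *)
Fixpoint tree_code (K D : Type) (t : tree K D) :
    set (seq K * option D) :=
  match t with
  | Leaf => set0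
  | Node c ch => fun p =>
      match p.1 with
      | [::] => if p.2 is Some d then c d else True
      | k :: s => tree_code (ch k) (s, p.2)
      end
  end.

Lemma tree_code_inj (K D : Type) : injective (@tree_code K D).
Proof.
elim=> [|c ch IH] [|c' ch'] //= e.
- by have [] : @set0 (seq K * option D) ([::], None) by rewrite e.
- by have [] : @set0 (seq K * option D) ([::], None) by rewrite -e.
have -> : c = c'.
  apply/funext => d.
  exact: (congr1 (fun P : set (seq K * option D) => P ([::], Some d)) e).
congr Node; apply/funext => k; apply: IH; apply/funext => -[s o].
exact: (congr1 (fun P : set (seq K * option D) => P (k :: s, o)) e).
Qed.

Lemma card_tree (K D : Type) : [set: nat] #<= [set: K] ->
  [set: D] #<= [set: K] -> [set: tree K D] #<= [set: set K].
Proof.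
move=> infK DK.
apply: card_le_trans (card_le_injT (@tree_code_inj K D)) _.
apply/card_le_set/(infinite_prod infK (infinite_seq infK)).
have /card_le_trans : [set: option D] #<= [set: unit + D].
  apply: (@card_le_injT _ _ (fun o => if o is Some d then inr d else inl tt)).
  by move=> [d|] [d'|] // [->].
apply; apply: infinite_sum => //; apply: card_le_trans infK.
exact: countableP.
Qed.

(** The hull is the set of values of all terms, so its size is bounded by the
number of terms; it is closed under [F] because choosing a term for each
argument gives a term for the value. *)
Lemma infinitary_hull (K C X : Type) (F : C -> (K -> X) -> X) (x0 : X) :
  [set: nat] #<= [set: K] -> [set: C] #<= [set: set K] ->
  exists H : set X, [/\ H x0,
    forall c f, (forall k, H (f k)) -> H (F c f) &
    H #<= [set: set K]].
Proof.
move=> infK /(card_le_injP _ _ set0)[e [_ eI]].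
(* [d] decodes a label into the operation it names. *)
have [d de] : exists d : set K -> option C, forall c, d (e c) = Some c.
  have /choice[d dP] : forall P, exists o : option C,
      forall c, e c = P -> o = Some c.
    move=> P; have [[c <-]|nP] := pselect (exists c, e c = P).
      by exists (Some c) => c' /eI ->.
    by exists None => c ec; case: nP; exists c.
  by exists d => c; exact: dP.
pose ev := fix ev (t : tree K K) : X :=
  if t is Node P ch then
    if d P is Some c then F c (fun k => ev (ch k)) else x0
  else x0.
exists (range ev); split.
- by exists (Leaf _ _).
- move=> c f fH; have /choice[ch chP] : forall k, exists t, ev t = f k.
    by move=> k; have [t _ <-] := fH k; exists t.
  exists (Node (e c) ch) => //=; rewrite de; congr F.
  by apply/funext => k; exact: chP.
- exact: card_le_trans (card_image_le _ _) (card_tree infK (card_lexx _)).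
Qed.

(** * Covering the space by Urysohn widths *)

Lemma cl_theta_subset (X : topologicalType) (A B : set X) :
  A `<=` B -> cl_theta A `<=` cl_theta B.
Proof.
by move=> AB x xA U /xA[y [Uy Ay]]; exists y; split=> //; exact: AB.
Qed.

Lemma enumerated_base (X : topologicalType) (K : Type) (x : X) :
  local_character x #<= [set: K] ->
  exists U : K -> set X, (forall k, open_nbhs x (U k)) /\
    (forall V, open_nbhs x V -> exists k, U k `<=` V).
Proof.
have [[Bx Bbase] _] := local_characterP x.
have [V0 BV0 _] : exists2 V, local_character x V & V `<=` setT.
  by apply: Bbase; split=> //; exact: openT.
move=> /(card_le_surj BV0)[U [BU Usurj]]; exists U.
split=> [k|V /Bbase[W BW WV]]; first exact/Bx/BU.
by have [k _ Uk] := Usurj _ BW; exists k; rewrite Uk.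
Qed.

(** The description of [x] relative to the sequence [f]: which terms of [f] fall
in the closure of which basic neighbourhood of [x]. *)
Definition closure_trace (X : topologicalType) (K : Type) (U : X -> K -> set X)
  (f : K -> X) (x : X) : set (K * K) := [set p | closure (U x p.1) (f p.2)].

(** If infinitely many points had the same trace [R], take [n] of them and
separate them by basic neighbourhoods.  At one of these points, some basic
neighbourhood [U y j] is contained in all [U y (k i)], so [f j], which lies in
its closure because [R (j, j)], lies in the closure of each [U y (k i)].  This
is a property of [R], hence it holds at the [n] points alike, and [f j] belongs
to the [n] closures at once. *)
Lemma closure_trace_fiber_finite (n : nat) (X : topologicalType) (K : Type)
    (U : X -> K -> set X) (f : K -> X) (R : set (K * K)) :
  n_Urysohn n X -> (forall x k, open_nbhs x (U x k)) ->
  (forall x V, open_nbhs x V -> exists k, U x k `<=` V) ->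
  (forall k, R (k, k)) ->
  finite_set [set x | closure_trace U f x = R].
Proof.
move=> XU Unbhs Ubase RR; apply: contrapT => Rinf.
have [y0 _] := infinite_setN0 Rinf.
have /infiniteP/(card_le_injP _ _ y0)[g [gR gI]] := Rinf.
have [|V [Vg V0]] := XU (fun i => g i).
  by move=> i j /gI e; apply: val_inj; exact: e.
have /choice[k kV] : forall i : 'I_n, exists k, U (g i) k `<=` V i.
  by move=> i; exact: Ubase.
have : nbhs (g 0) [set y | forall i : 'I_n, U (g 0) (k i) y].
  by apply: filter_forall => i; apply: open_nbhs_nbhs; exact: Unbhs.
rewrite nbhsE => -[W gW WU]; have [j jW] := Ubase _ _ gW.
have Rg m : closure_trace U f (g m) = R by exact: gR.
suff : (\bigcap_(i in [set: 'I_n]) closure (V i)) (f j) by rewrite V0.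
move=> i _; apply: (closureS (kV i)).
suff : closure_trace U f (g i) (k i, j) by [].
rewrite Rg -(Rg 0); have : closure_trace U f (g 0) (j, j) by rewrite Rg.
by apply: closureS => y /jW /WU; exact.
Qed.

(** The set [H] is the hull of a point under two families of operations, both
named by a relation on [K]: [Some i] picks the [i]-th point with the given
trace, which makes [H] theta-closed, and [None] picks a point outside the union
of the sets [cl_theta (closure (U (f j) k))] with [(j, k)] in the relation. *)
Lemma Uw_cover (n : nat) (X : topologicalType) (K : Type) (x0 : X) :
  n_Urysohn n X -> [set: nat] #<= [set: K] ->
  (forall x : X, local_character x #<= [set: K]) ->
  (forall B : set X, theta_closed B -> theta_aL B #<= [set: K]) ->
  exists2 H : set X, H #<= [set: set K] & forall q, exists2 x, H x & Uw x q.
Proof.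
move=> XU infK charK aLK.
have /choice[U UP] := fun x => enumerated_base (charK x).
have Unbhs x : forall k, open_nbhs x (U x k) by have [] := UP x.
have Ubase x : forall V, open_nbhs x V -> exists k, U x k `<=` V.
  by have [] := UP x.
have /choice[e eP] : forall p : set (K * K) * (K -> X), exists e : nat -> X,
    (forall k, p.1 (k, k)) ->
    [set x | closure_trace U p.2 x = p.1] `<=` range e.
  move=> [R f] /=; have [RR|nR] := pselect (forall k, R (k, k)); last first.
    by exists (fun=> x0) => /nR.
  have [->|/set0P[x xR]] := eqVneq [set x | closure_trace U f x = R] set0.
    by exists (fun=> x0) => _ y.
  have := finite_set_countable (closure_trace_fiber_finite f XU Unbhs Ubase RR).
  move=> /(card_le_surj xR)[e [_ eR]]; exists e => _ y /eR[i _ <-].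
  by exists i.
pose missed (S : set (K * K)) (f : K -> X) :=
  ~` \bigcup_(p in S) cl_theta (closure (U (f p.1) p.2)).
pose F (c : set (K * K) * option nat) (f : K -> X) :=
  if c.2 is Some i then e (c.1, f) i else xget x0 (missed c.1 f).
have CK : [set: set (K * K) * option nat] #<= [set: set K].
  apply: (@card_le_trans _ _ _ [set: set (K * K + option nat)]).
    apply: (@card_le_injT _ _ (fun c s =>
      match s with inl p => c.1 p | inr o => o = c.2 end)).
    move=> [R o] [R' o'] /= E.
    have -> : R = R'.
      by apply/funext => p; exact: (congr1 (fun P => P (inl p)) E).
    by congr pair; rewrite -(congr1 (fun P => P (inr o)) E).
  apply/card_le_set/(infinite_sum infK); first exact: infinite_prod.
  by apply: card_le_trans infK; exact: countableP.
have [H [Hx0 HF HK]] := infinitary_hull F x0 infK CK.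
exists H => // q.
have Hclosed : theta_closed H.
  apply/seteqP; split=> [x Hx V [_ Vx]|x xH].
    by exists x; split=> //; exact: subset_closure.
  have /choice[f fP] : forall k, exists y, closure (U x k) y /\ H y.
    by move=> k; have [y [Uy Hy]] := xH _ (Unbhs x k); exists y.
  have [||i _ <-] := eP (closure_trace U f x, f) _ x; [|by []|].
    by move=> k; have [] := fP k.
  by apply: (HF (_, Some i)) => k; have [] := fP k.
apply: contrapT => nq.
pose V := [set v | exists x k,
  [/\ H x, v = U x k & ~ cl_theta (closure (U x k)) q]].
have Vopen : V `<=` open.
  by move=> _ [x [k [_ -> _]]]; have [] := Unbhs x k.
have HV : H `<=` \bigcup_(v in V) v.
  move=> x Hx; have : ~ Uw x q by move=> xq; apply: nq; exists x.
  move=> /existsNP[O /not_implyP[xO nO]]; have [k kO] := Ubase _ _ xO.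
  exists (U x k); last by have [] := Unbhs x k.
  exists x, k; split=> // kq; apply: nO.
  exact: cl_theta_subset (closureS kO) _ kq.
have [V' [V'V V'K HV']] := theta_aLP Vopen HV.
have [v0 V'v0 _] := HV' _ Hx0.
have [g [gV' gsurj]] :=
  card_le_surj V'v0 (card_le_trans V'K (aLK _ Hclosed)).
(* [f j] and [h j] name the [j]-th member [U (f j) (h j)] of the subcover. *)
have /choice[f /choice[h fh]] := fun j => V'V _ (gV' j).
pose S : set (K * K) := [set p | p.2 = h p.1].
have mq : missed S f q.
  move=> [[j k] Sjk]; have [_ _] := fh j.
  by rewrite -(Sjk : k = h j).
have Hz : H (F (S, None) f) by apply: HF => j; have [] := fh j.
have zm : missed S f (F (S, None) f) by apply: (xgetPex x0); exists q.
have [v /gsurj[j _ <-] vz] := HV' _ Hz; apply: zm; exists (j, h j) => //=.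
by have [_ <- _] := fh j.
Qed.

Theorem theorem3p1 (n : nat) (hn : (1 <= n)%N) (X : topologicalType)
    (hT1 : accessible_space X) (hU : n_Urysohn n X) :
  [set: X] #<= UW X `*` [set: set (theta_aL_theta X * character X)].
Proof.
have [[x0 _]|nX] := pselect (exists x : X, True); last first.
  suff -> : [set: X] = set0 by [].
  by apply/seteqP; split=> // x _; apply: nX; exists x.
pose k1 : theta_aL_theta X := inl 0; pose k2 : character X := inl 0.
have [|||H HK Hcover] := @Uw_cover n X (theta_aL_theta X * character X) x0 hU.
- by apply: (@card_le_injT _ _ (fun m => (inl m, k2))) => m m' [].
- move=> x; apply: card_le_trans (sup_card_ge _ (I : [set: X] x)) _.
  by apply: (@card_le_inr nat _ _ _ (fun k => (k1, k))) => k k' [].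
- move=> B Bclosed; apply: card_le_trans (sup_card_ge _ Bclosed) _.
  by apply: (@card_le_inr nat _ _ _ (fun k => (k, k2))) => k k' [].
apply: card_le_trans
  (card_le_bigcup HK (fun x _ => sup_card_ge _ (I : setT x))).
by apply: subset_card_le => q _; have [x Hx xq] := Hcover q; exists x.
Qed.
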